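(* Let $I$ be a non-empty subset of $\mathbb{N}$ and let $S\subseteq \mathbb{N}^{(I)}$ be a gap absorbing monoid. Then $S$ is an ideal extension of $\mathbb{N}^{(I)}$.
   Context: $\mathbb{N}$ is the set of non-negative integers. For a non-empty set $I\subseteq\mathbb{N}$, $\mathbb{N}^{(I)}$ is the additive monoid (componentwise addition) of all sequences $(n_i)_{i\in I}$ of non-negative integers with $n_i=0$ for all but finitely many $i$; $\mathbf{0}$ is the zero sequence. For $X,Y\subseteq\mathbb{N}^{(I)}$, $X+Y=\{x+y: x\in X,\ y\in Y\}$ and $2X=X+X$. For a submonoid $S$ of $\mathbb{N}^{(I)}$: $S^*=S\setminus\{\mathbf{0}\}$; $\mathcal{H}(S)=\mathbb{N}^{(I)}\setminus S$ is the set of gaps; $\mathcal{A}(S)=S^*\setminus(S^*+S^* )$ is the set of atoms. A subset $E\subseteq\mathbb{N}^{(I)}$ is an ideal if $E+\mathbb{N}^{(I)}\subseteq E$; $S$ is an ideal extension of $\mathbb{N}^{(I)}$ if $S=E\cup\{\mathbf{0}\}$ for some ideal $E$ of $\mathbb{N}^{(I)}$. A submonoid $S$ of $\mathbb{N}^{(I)}$ is gap absorbing if $2\mathcal{H}(S)\subseteq\mathcal{H}(S)\cup\mathcal{A}(S)\cup 2\mathcal{A}(S)$ and $\mathcal{H}(S)+\mathcal{A}(S)\subseteq\mathcal{A}(S)\cup 2\mathcal{A}(S)$. *)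

(* Defs.v *)
From HB Require Import structures.
From mathcomp Require Import all_boot all_algebra finmap multiset.
From mathcomp Require Import boolp classical_sets.

Set Implicit Arguments.
Unset Strict Implicit.
Unset Printing Implicit Defensive.

Import GRing.Theory.

Local Open Scope classical_set_scope.
Local Open Scope ring_scope.

(* The monoid N^(I): a multiset over I is by definition a finitely supported
   function I -> nat, and the multiset sum msetD is the componentwise sum. *)
Definition finsupp_seq (I : set nat) : Type := {mset I}%mset.

HB.instance Definition _ (I : set nat) := Choice.on (finsupp_seq I).

Section FinsuppSeqNmodule.
Variable I : set nat.
Implicit Types x y z : finsupp_seq I.

Let zero : finsupp_seq I := mset0.
Let add x y : finsupp_seq I := msetD x y.

Fact finsupp_seq_addA : associative add.
Proof. by move=> x y z; apply/msetP=> i; rewrite /add !msetE2 addnA. Qed.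

Fact finsupp_seq_addC : commutative add.
Proof. by move=> x y; apply/msetP=> i; rewrite /add !msetE2 addnC. Qed.

Fact finsupp_seq_add0 : left_id zero add.
Proof. by move=> x; apply/msetP=> i; rewrite /add !msetE2 mset0E add0n. Qed.

HB.instance Definition _ := GRing.isNmodule.Build (finsupp_seq I)
  finsupp_seq_addA finsupp_seq_addC finsupp_seq_add0.
End FinsuppSeqNmodule.

Section GapAbsorbing.
Variable V : nmodType.
Implicit Types X Y S E : set V.

Definition sumset X Y : set V := [set x + y | x in X & y in Y].

Definition submonoid S : Prop := GRing.nmod_closed (mem S).

Definition nonzero S : set V := S `\ 0.

Definition gaps S : set V := ~` S.

Definition atoms S : set V :=
  nonzero S `\` sumset (nonzero S) (nonzero S).

Definition ideal E : Prop := sumset E setT `<=` E.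

Definition ideal_extension S : Prop := exists E, ideal E /\ S = E `|` [set 0].

Definition gap_absorbing S : Prop :=
  sumset (gaps S) (gaps S)
    `<=` gaps S `|` atoms S `|` sumset (atoms S) (atoms S) /\
  sumset (gaps S) (atoms S) `<=` atoms S `|` sumset (atoms S) (atoms S).

End GapAbsorbing.

(* Main.v *)
Require Import Defs.
From mathcomp Require Import all_boot all_algebra.
From mathcomp Require Import boolp classical_sets.
From mathcomp Require Import finmap multiset.

(** The total size of a sequence is additive and vanishes only at zero, so every
    nonzero element of S has an atom as a summand.  A gap plus an atom lies in S
    by the second gap absorbing condition, hence so does a gap plus any nonzero
    element of S.  Thus the nonzero elements of S form an ideal. *)

Set Implicit Arguments.
Unset Strict Implicit.
Unset Printing Implicit Defensive.

Local Open Scope classical_set_scope.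

Section AtomicSubmonoid.
Local Open Scope ring_scope.
Import GRing.Theory.
Variables (V : nmodType) (size : V -> nat).
Hypothesis sizeD : {morph size : x y / x + y >-> (x + y)%N}.
Hypothesis size_eq0 : forall x, size x = 0%N -> x = 0.
Variable S : set V.
Hypothesis submonoidS : submonoid S.

Lemma submonoid0 : S 0.
Proof. by case: submonoidS => /set_mem. Qed.

Lemma submonoidD x y : S x -> S y -> S (x + y).
Proof.
by case: submonoidS => _ SD Sx Sy; apply/set_mem/SD; apply/mem_set.
Qed.

Lemma size_gt0 (x : V) : x <> 0 -> (0 < size x)%N.
Proof. by move=> x0; rewrite lt0n; apply/eqP => /size_eq0. Qed.

(** Additivity gives [size 0 = 0] by cancellation, so [x + y = 0] would force [size x = 0]. *)
Lemma nonzeroD (x y : V) : x <> 0 -> x + y <> 0.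
Proof.
move=> x0 xy0; have size0 : size (0 : V) = 0%N.
  by apply: (@addnI (size (0 : V))); rewrite -sizeD addr0 addn0.
by have := size_gt0 x0; rewrite lt0n -leqn0 -size0 -xy0 sizeD leq_addr.
Qed.

(** Strong induction on size: if [x] is not an atom, it splits as [u + v] with [u] strictly smaller,
    and an atom of [u] serves for [x]. *)
Lemma atom_summand x : nonzero S x -> exists a t, [/\ atoms S a, S t & x = a + t].
Proof.
have [n] := ubnP (size x); elim: n x => // n IHn x le_x_n Sx.
have [[u Su [v Sv uvx]]|irr] := pselect (sumset (nonzero S) (nonzero S) x); last first.
  by exists x, 0; rewrite addr0; split=> //; apply: submonoid0.
have lt_u_x : (size u < size x)%N.
  by rewrite -uvx sizeD -[X in (X < _)%N]addn0 ltn_add2l size_gt0 //; case: Sv.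
have [a [t [aS St u_at]]] := IHn u (leq_trans lt_u_x le_x_n) Su.
exists a, (t + v); split=> //; first by apply: submonoidD => //; case: Sv.
by rewrite addrA -u_at uvx.
Qed.

Lemma atoms_sub : atoms S `<=` S.
Proof. by move=> a [[]]. Qed.

Lemma gap_absorbing_ideal_extension : gap_absorbing S -> ideal_extension S.
Proof.
case=> _ gapDatom; exists (nonzero S); split; last first.
  apply/seteqP; split=> [x Sx|x [[]//|->]]; last exact: submonoid0.
  by have [->|x0] := pselect (x = 0); [right | left].
move=> _ [x Sx [y _ <-]]; split; last by apply: nonzeroD; case: Sx.
(* Closure of [S] settles [y] in [S]; only a gap [y] needs an atom of [x]. *)
have [Sy|gap_y] := pselect (S y); first by apply: submonoidD => //; case: Sx.
have [a [t [aS St ->]]] := atom_summand Sx.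
(* Regroup [a + t + y] as [(a + y) + t]: since [t] is in [S], only gap plus atom remains. *)
rewrite addrAC; apply: submonoidD => //; rewrite addrC.
have [|/atoms_sub//|[b /atoms_sub Sb [c /atoms_sub Sc <-]]] := gapDatom (y + a).
  by exists y => //; exists a.
exact: submonoidD.
Qed.

End AtomicSubmonoid.

(** Multiplicities add, so the enumeration of the sum is a permutation of the concatenated
    enumerations. *)
Lemma size_msetD (K : choiceType) (A B : {mset K}%mset) :
  size (msetD A B) = (size A + size B)%N.
Proof.
rewrite -size_cat; apply: perm_size; apply/allP => x _ /=.
by rewrite count_cat !count_mem_mset msetE2.
Qed.

Theorem proposition2p2 (I : set nat) (hI : I !=set0)
    (S : set (finsupp_seq I)) (hS : submonoid S) (hgap : gap_absorbing S) :
  ideal_extension S.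
Proof.
(* Counting with multiplicity, [sz x] is the sum of the coordinates of [x]. *)
pose sz (x : finsupp_seq I) := size (x : {mset I}%mset).
apply: (@gap_absorbing_ideal_extension _ sz) => //.
  by move=> x y; apply: size_msetD.
by move=> x /eqP; rewrite size_mset_eq0 => /eqP.
Qed.
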